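(* The sphere bundles $E^1_{2,7}\to G(2,7)$ and $E^1_{3,8}\to G(3,8)$ do not admit parallel sections, not even local ones: for $(k,n)\in\{(2,7),(3,8)\}$ and any nonempty open subset $U\subset G(k,n)$, there is no smooth section $\sigma:U\to E^1_{k,n}$ with $\nabla\sigma=0$.
   Context: $G(k,n)$ is the manifold of oriented $k$-dimensional subspaces of $\mathbb{R}^n$. $E_{k,n}=\{(P,v)\in G(k,n)\times\mathbb{R}^n\mid v\perp P\}\to G(k,n)$ is a Riemannian vector bundle (fibers inherit the inner product of $\mathbb{R}^n$), with metric connection $\nabla$ given by $(\nabla_Y\sigma)_P=(P,\pi_P((dx)_P(Y_P)))$ for a section $\sigma(Q)=(Q,x(Q))$, where $\pi_P$ is the orthogonal projection of $\mathbb{R}^n$ onto $P^\perp$. $E^1_{k,n}=\{(P,v)\in E_{k,n}\mid\|v\|=1\}$. *)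

(* Defs.v *)
From HB Require Import structures.
From mathcomp Require Import all_boot all_order all_algebra.
From mathcomp Require Import all_classical all_reals all_analysis.

Set Implicit Arguments.
Unset Strict Implicit.
Unset Printing Implicit Defensive.

Import Order.TTheory GRing.Theory Num.Theory.
Import numFieldNormedType.Exports.

Local Open Scope classical_set_scope.
Local Open Scope ring_scope.

(* R^n is 'rV[R]_n; the library norm of 'rV[R]_n is the sup norm, so the      *)
(* Euclidean structure is given by [dotr] and [enorm].                        *)

Definition dotr (R : realType) (n : nat) (u v : 'rV[R]_n) : R :=
  (u *m v^T) 0 0.

Definition enorm (R : realType) (n : nat) (v : 'rV[R]_n) : R :=
  Num.sqrt (dotr v v).

(* Kernel of w |-> (<w, e_i>)_i, for (e_i) a basis of V; see [mem_orthov].    *)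
Definition orthov (R : realType) (n : nat) (V : {vspace 'rV[R]_n}) :
    {vspace 'rV[R]_n} :=
  lker (linfun (mulmxr (\matrix_(i < \dim V) (vbasis V)`_i)^T)).

(* The orthogonal projection onto the orthogonal complement of V; see         *)
(* [eproj_mem] and [eproj_sub].                                               *)
Definition eproj (R : realType) (n : nat) (V : {vspace 'rV[R]_n}) :
    'rV[R]_n -> 'rV[R]_n :=
  daddv_pi (orthov V) V.

Lemma dotrE (R : realType) (n : nat) (u v : 'rV[R]_n) :
  dotr u v = \sum_i u 0 i * v 0 i.
Proof. by rewrite /dotr mxE; apply: eq_bigr => i _; rewrite mxE. Qed.

Lemma mem_orthov (R : realType) (n : nat) (V : {vspace 'rV[R]_n})
    (v : 'rV[R]_n) :
  v \in orthov V <-> forall u, u \in V -> dotr u v = 0.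
Proof.
rewrite /orthov memv_ker lfunE /=; split=> [/eqP h u uV|h].
  have hb (i : 'I_(\dim V)) : dotr (vbasis V)`_i v = 0.
    have := congr1 (fun M : 'rV_ _ => M 0 i) h; rewrite !mxE => <-.
    rewrite dotrE; apply: eq_bigr => j _.
    by rewrite !mxE mulrC.
  rewrite (coord_vbasis uV) /dotr mulmx_suml summxE big1 // => i _.
  by rewrite -scalemxAl mxE -/(dotr _ _) hb mulr0.
apply/eqP/rowP => i; rewrite !mxE.
have hi : (vbasis V)`_i \in V by apply/vbasis_mem/mem_nth; rewrite size_tuple.
apply: etrans (h _ hi); rewrite dotrE; apply: eq_bigr => j _.
by rewrite !mxE mulrC.
Qed.

Lemma orthov_cap (R : realType) (n : nat) (V : {vspace 'rV[R]_n}) :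
  (orthov V :&: V = 0)%VS.
Proof.
apply/eqP; rewrite -subv0; apply/subvP => v; rewrite memv_cap memv0.
case/andP=> /mem_orthov vo vV; have := vo _ vV.
rewrite dotrE => /eqP; rewrite psumr_eq0; last by move=> i _; exact: sqr_ge0.
move=> /allP h; apply/eqP/rowP => i; rewrite mxE.
have := h i; rewrite mem_index_enum => /(_ isT) /=.
by rewrite mulf_eq0 orbb => /eqP.
Qed.

Lemma orthov_add (R : realType) (n : nat) (V : {vspace 'rV[R]_n}) :
  (orthov V + V = fullv)%VS.
Proof.
apply/eqP; rewrite eqEdim subvf /= dimv_disjoint_sum ?orthov_cap //.
pose f : 'Hom('rV[R]_n, 'rV[R]_(\dim V)) :=
  linfun (mulmxr (\matrix_(i < \dim V) (vbasis V)`_i)^T).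
rewrite -(limg_ker_dim f fullv) capfv leq_add2l.
by apply: leq_trans (dimvS (subvf _)) _; rewrite dimvf /dim /= mul1n.
Qed.

Lemma eproj_mem (R : realType) (n : nat) (V : {vspace 'rV[R]_n})
    (w : 'rV[R]_n) :
  eproj V w \in orthov V.
Proof. exact: memv_pi. Qed.

Lemma eproj_sub (R : realType) (n : nat) (V : {vspace 'rV[R]_n})
    (w : 'rV[R]_n) :
  w - eproj V w \in V.
Proof.
have wf : w \in (orthov V + V)%VS by rewrite orthov_add memvf.
by rewrite -{1}(daddv_pi_add (orthov_cap V) wf) addrC addKr memv_pi.
Qed.

(* [Ck r D f], for D open: f is of class C^r on D.                            *)
Fixpoint Ck (R : realType) (V W : normedModType R) (r : nat) (D : set V)
    (f : V -> W) : Prop :=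
  if r is r'.+1 then
    (forall x, D x -> differentiable f x) /\
    (forall v : V, Ck r' D (fun x => 'D_v f x))
  else forall x, D x -> {for x, continuous f}.

Definition smooth_on (R : realType) (V W : normedModType R) (D : set V)
    (f : V -> W) : Prop :=
  forall r : nat, Ck r D f.

(* A k-frame is a matrix whose k rows are the vectors of the frame; two bases *)
(* of a subspace have the same orientation when the change of basis matrix g  *)
(* has positive determinant.                                                  *)
Definition rows_seq (R : realType) (k n : nat) (A : 'M[R]_(k, n)) :
    seq 'rV[R]_n :=
  [seq row i A | i : 'I_k].

Definition same_orientation (R : realType) (k n : nat) (A : 'M[R]_(k, n)) :
    set 'M[R]_(k, n) :=
  [set B | exists2 g : 'M[R]_k, 0 < \det g & B = g *m A].

(* An orientation is the set of all the positively oriented bases.            *)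
Record ograss (R : realType) (k n : nat) := OGrass {
  osub : {vspace 'rV[R]_n} ;
  oframes : set 'M[R]_(k, n) ;
  ograssP : exists2 A : 'M[R]_(k, n),
    basis_of osub (rows_seq A) & oframes = same_orientation A
}.

Lemma basis_rows (R : realType) (k n : nat) (A : 'M[R]_(k, n)) :
  row_free A -> basis_of <<rows_seq A>>%VS (rows_seq A).
Proof.
move=> fA; rewrite basisEfree span_def subvv /=.
have -> : free (rows_seq A).
  have -> : rows_seq A = [tuple row i A | i < k] by [].
  apply/freeP => c hc i.
  have cA : (\row_i c i) *m A = 0.
    rewrite mulmx_sum_row -[RHS]hc; apply: eq_bigr => j _.
    by rewrite mxE (nth_map j) ?size_enum_ord // nth_ord_enum.
  by move/(row_free_inj fA)/rowP/(_ i): (etrans cA (esym (mul0mx _ A)));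
     rewrite !mxE.
by rewrite /= -span_def dim_span.
Qed.

Definition ospan (R : realType) (k n : nat) (A : 'M[R]_(k, n))
    (fA : row_free A) : ograss R k n :=
  OGrass (ex_intro2 _ _ A (basis_rows fA) erefl).

(* The charts.  A basis of R^n, split into k vectors (rows of A) and n - k    *)
(* vectors (rows of C), parametrizes the oriented graphs of the linear maps   *)
(* span A -> span C, with the orientation transported from A, by              *)
(* X |-> span (A + X C).                                                      *)
Record ochart (R : realType) (k n : nat) := OChart {
  chartA : 'M[R]_(k, n) ;
  chartC : 'M[R]_(n - k, n) ;
  chart_free : row_free (col_mx chartA chartC)
}.

Lemma chart_row_free (R : realType) (k n : nat) (c : ochart R k n)
    (X : 'M[R]_(k, n - k)) :
  row_free (chartA c + X *m chartC c).
Proof.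
rewrite -kermx_eq0 -submx0; apply/rV_subP => u /sub_kermxP.
rewrite mulmxDr mulmxA -mul_row_col => h.
have := row_free_inj (chart_free c) (etrans h (esym (mul0mx _ _))).
by rewrite -row_mx0 => /eq_row_mx [-> _]; exact: sub0mx.
Qed.

Definition oparam (R : realType) (k n : nat) (c : ochart R k n)
    (X : 'M[R]_(k, n - k)) : ograss R k n :=
  ospan (chart_row_free c X).

(* The manifold topology of G(k, n): final for the chart parametrizations.    *)
Definition ograss_open (R : realType) (k n : nat) (U : set (ograss R k n)) :=
  forall c : ochart R k n, open (oparam c @^-1` U).

Section OGrassTopology.
Variables (R : realType) (k n : nat).

HB.instance Definition _ := gen_eqMixin (ograss R k n).
HB.instance Definition _ := gen_choiceMixin (ograss R k n).

Let ograss_openT : ograss_open [set: ograss R k n].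
Proof. by move=> c; rewrite preimage_setT; exact: openT. Qed.

Let ograss_openI (U V : set (ograss R k n)) :
  ograss_open U -> ograss_open V -> ograss_open (U `&` V).
Proof. by move=> oU oV c; rewrite preimage_setI; exact: openI. Qed.

Let ograss_open_bigU (I : Type) (F : I -> set (ograss R k n)) :
  (forall i, ograss_open (F i)) -> ograss_open (\bigcup_i F i).
Proof.
by move=> oF c; rewrite preimage_bigcup; apply: bigcup_open => i _; exact: oF.
Qed.

HB.instance Definition _ := @isOpenTopological.Build (ograss R k n)
  (@ograss_open R k n) ograss_openT ograss_openI ograss_open_bigU.

End OGrassTopology.

(* Tangent vectors at P in coordinates: d(oparam c)_X(H), where               *)
(* oparam c X = P.  Several triples (c, X, H) represent the same vector.      *)
Record tvec (R : realType) (k n : nat) (P : ograss R k n) := TVec {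
  tv_chart : ochart R k n ;
  tv_pt : 'M[R]_(k, n - k) ;
  tv_dir : 'M[R]_(k, n - k) ;
  tv_at : oparam tv_chart tv_pt = P
}.

Definition smooth_map (R : realType) (k n : nat) (W : normedModType R)
    (U : set (ograss R k n)) (x : ograss R k n -> W) : Prop :=
  forall c : ochart R k n, smooth_on (oparam c @^-1` U) (x \o oparam c).

Definition dmap (R : realType) (k n : nat) (W : normedModType R)
    (x : ograss R k n -> W) (P : ograss R k n) (Y : tvec P) : W :=
  'd (x \o oparam (tv_chart Y)) (tv_pt Y) (tv_dir Y).

Definition Ebundle (R : realType) (k n : nat) :
    set (ograss R k n * 'rV[R]_n) :=
  [set e | e.2 \in orthov (osub e.1)].

Definition E1bundle (R : realType) (k n : nat) :
    set (ograss R k n * 'rV[R]_n) :=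
  [set e | Ebundle e /\ enorm e.2 = 1].

Arguments Ebundle R k n : clear implicits.
Arguments E1bundle R k n : clear implicits.

(* A section over U is a function on the whole Grassmannian, whose values     *)
(* outside U are irrelevant.                                                  *)
Definition section_over (R : realType) (k n : nat)
    (B : set (ograss R k n * 'rV[R]_n)) (U : set (ograss R k n))
    (s : ograss R k n -> ograss R k n * 'rV[R]_n) : Prop :=
  forall P, U P -> B (s P) /\ (s P).1 = P.

(* The bundles are submanifolds of G(k, n) x R^n, and the first component of  *)
(* a section is the identity, so only the second one has to be smooth.        *)
Definition smooth_section (R : realType) (k n : nat)
    (U : set (ograss R k n))
    (s : ograss R k n -> ograss R k n * 'rV[R]_n) : Prop :=
  smooth_map U (fun P => (s P).2).

Definition nabla (R : realType) (k n : nat)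
    (s : ograss R k n -> ograss R k n * 'rV[R]_n)
    (P : ograss R k n) (Y : tvec P) : ograss R k n * 'rV[R]_n :=
  (P, eproj (osub P) (dmap (fun Q => (s Q).2) Y)).

Definition parallel (R : realType) (k n : nat) (U : set (ograss R k n))
    (s : ograss R k n -> ograss R k n * 'rV[R]_n) : Prop :=
  forall P, U P -> forall Y : tvec P, nabla s Y = (P, 0).

(* Main.v *)
From HB Require Import structures.
Require Import Defs.
From mathcomp Require Import all_boot all_order all_algebra.
From mathcomp Require Import all_classical all_reals all_analysis.
From mathcomp Require Import ring lra.

(** A parallel section is fixed by parallel transport around every small loop,
but the bundle is curved, and already so over a two-parameter family of
subspaces that is a copy of a piece of the round sphere.  Such a family exists
as soon as [0 < k] and [k + 2 <= n], which is the generality of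
[no_parallel_section].

Fix [P] in [U], a unit vector [e] in [P], and let [S] be the orthogonal
complement of [P].  Each [z] in [S] tilts [P] to the subspace
[Q_z = {w + <w, e> z | w in P}], which turns [e] into [e + z] and keeps the
part of [P] orthogonal to [e].  Let [F z] be the value at [Q_z] of a parallel
unit section.  It is orthogonal to [e + z], and its derivatives lie in [Q_z],
hence have the form [w + <w, e> z].  Differentiating [<F z, e + z> = 0] in a
direction [v] of [S] determines [<w, e>] and gives the transport equation

  [(1 + |z|^2) <dF_z v, w> = - <F z, v> <z, w>]      for [v], [w] in [S]

(lemma [parallel_transport_at]).  Integrating it along the segment from [0] to
[z] shows that [<F z, z>^2 (1 + |z|^2) = <F 0, z>^2] and that [<F z, w>] does
not move when [w] is orthogonal to [z].

As [dim S >= 2], there is a unit vector [h] in [S] orthogonal to the unit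
vector [f = F 0].  On the plane [z = q h + p f] the integrated identity reads
[N(p)^2 (1 + q^2 + p^2) = p^2] with [N(p) = <F z, z>], so that
[N'(0)^2 (1 + q^2) = 1].  The transport equation at [q h], where
[<F (q h), f> = <F 0, f> = 1], yields [N'(0) = 1 - q^2 / (1 + q^2)], that is
[N'(0) = 1 / (1 + q^2)].  Both hold only for [q = 0]; any small [q > 0] is a
contradiction (lemma [transport_obstruction]).  Comparing transport along rays
in this way replaces the symmetry of second derivatives of [F]. *)

Set Implicit Arguments.
Unset Strict Implicit.
Unset Printing Implicit Defensive.

Import Order.TTheory GRing.Theory Num.Theory.
Import numFieldNormedType.Exports.

Local Open Scope classical_set_scope.
Local Open Scope ring_scope.

(** * The Euclidean inner product *)

Lemma dotrC (R : realType) (n : nat) (u v : 'rV[R]_n) : dotr u v = dotr v u.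
Proof. by rewrite !dotrE; apply: eq_bigr => i _; rewrite mulrC. Qed.

Lemma dotrDl (R : realType) (n : nat) (u v w : 'rV[R]_n) :
  dotr (u + v) w = dotr u w + dotr v w.
Proof. by rewrite /dotr mulmxDl mxE. Qed.

Lemma dotrZl (R : realType) (n : nat) (a : R) (u w : 'rV[R]_n) :
  dotr (a *: u) w = a * dotr u w.
Proof. by rewrite /dotr -scalemxAl mxE. Qed.

Lemma dotrDr (R : realType) (n : nat) (u v w : 'rV[R]_n) :
  dotr w (u + v) = dotr w u + dotr w v.
Proof. by rewrite dotrC dotrDl !(dotrC w). Qed.

Lemma dotrZr (R : realType) (n : nat) (a : R) (u w : 'rV[R]_n) :
  dotr w (a *: u) = a * dotr w u.
Proof. by rewrite dotrC dotrZl dotrC. Qed.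

Lemma dotr0l (R : realType) (n : nat) (w : 'rV[R]_n) : dotr 0 w = 0.
Proof. by rewrite /dotr mul0mx mxE. Qed.

Lemma dotr_mulmxr (R : realType) (m n : nat) (u : 'rV[R]_m) (v : 'rV[R]_n)
    (B : 'M[R]_(n, m)) :
  dotr u (v *m B) = dotr (u *m B^T) v.
Proof. by rewrite /dotr trmx_mul mulmxA. Qed.

Lemma dotr_ge0 (R : realType) (n : nat) (u : 'rV[R]_n) : 0 <= dotr u u.
Proof. by rewrite dotrE; apply: sumr_ge0 => i _; rewrite -expr2 sqr_ge0. Qed.

Lemma dotr_eq0 (R : realType) (n : nat) (u : 'rV[R]_n) :
  (dotr u u == 0) = (u == 0).
Proof.
apply/eqP/eqP => [u0|->]; last exact: dotr0l.
have /eqP := orthov_cap <[u]>%VS; rewrite -subv0 => /subvP/(_ u).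
rewrite memv_cap memv_line andbT memv0 => h; apply/eqP/h/mem_orthov => w.
by case/vlineP=> a ->; rewrite dotrZl u0 mulr0.
Qed.

Lemma dotr_normalize (R : realType) (n : nat) (u : 'rV[R]_n) :
  u != 0 -> exists a : R, dotr (a *: u) (a *: u) = 1.
Proof.
rewrite -dotr_eq0 => u0; exists (Num.sqrt (dotr u u))^-1.
rewrite dotrZl dotrZr mulrA -invfM -expr2 sqr_sqrtr ?dotr_ge0 // mulVf //.
Qed.

Lemma exists_unit_orthogonal (R : realType) (m n : nat) (B : 'M[R]_(m, n)) :
  (m < n)%N -> exists h : 'rV[R]_n, h *m B^T = 0 /\ dotr h h = 1.
Proof.
move=> mn; have : kermx B^T != 0.
  rewrite kermx_eq0 /row_free mxrank_tr neq_ltn.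
  by rewrite (leq_ltn_trans (rank_leq_row _)).
case/rowV0Pn => v /sub_kermxP vB /dotr_normalize[a av].
by exists (a *: v); rewrite -scalemxAl vB scaler0.
Qed.

(** * Subspaces spanned by rows, and charts adapted to a subspace *)

Lemma nth_rows_seq (R : realType) (k n : nat) (A : 'M[R]_(k, n)) (i : 'I_k) :
  (rows_seq A)`_i = row i A.
Proof. by rewrite (nth_map i) ?size_enum_ord // nth_ord_enum. Qed.

Lemma mem_span_rows (R : realType) (k n : nat) (A : 'M[R]_(k, n))
    (v : 'rV[R]_n) :
  v \in <<rows_seq A>>%VS <-> exists u, v = u *m A.
Proof.
have -> : rows_seq A = [tuple row i A | i < k] by [].
split=> [/coord_span vE|[u ->]].
  exists (\row_i coord [tuple row i A | i < k] i v).
  rewrite mulmx_sum_row {1}vE; apply: eq_bigr => i _.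
  by rewrite mxE -nth_rows_seq.
rewrite mulmx_sum_row memv_suml // => i _.
by apply/memvZ/memv_span/mapP; exists i; rewrite ?mem_enum.
Qed.

Lemma exists_orthogonal_complement (R : realType) (k n : nat)
    (A : 'M[R]_(k, n)) :
  row_free A ->
  exists C : 'M[R]_(n - k, n), row_free (col_mx A C) /\
    forall v : 'rV[R]_n, v *m A^T = 0 <-> exists x, v = x *m C.
Proof.
move=> fA; pose r := \rank (kermx A^T).
have rE : r = (n - k)%N by rewrite /r mxrank_ker mxrank_tr (eqP fA).
move: (row_base_free (kermx A^T)) (eq_row_base (kermx A^T)).
move: (row_base _); rewrite -/r rE => C fC CE; exists C.
have CP v : v *m A^T = 0 <-> exists x, v = x *m C.
  split=> [/sub_kermxP|[x ->]]; first by rewrite -CE => /submxP.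
  by apply/sub_kermxP; rewrite -CE submxMl.
split=> //.
(* A vanishing combination of both blocks puts u A in the row spaces of both
   A and C, where it is orthogonal to itself. *)
rewrite -kermx_eq0 -submx0; apply/rV_subP => u /sub_kermxP.
rewrite -{1}[u]hsubmxK mul_row_col => uAC.
have uA : lsubmx u *m A = 0.
  apply/eqP; rewrite -dotr_eq0 dotr_mulmxr.
  have /CP -> : exists x, lsubmx u *m A = x *m C.
    exists (- rsubmx u); rewrite mulNmx.
    by apply/eqP; rewrite -addr_eq0 uAC.
  by rewrite dotr0l.
have uC : rsubmx u *m C = 0 by rewrite -uAC uA add0r.
rewrite -[u]hsubmxK (row_free_inj fA (etrans uA (esym (mul0mx _ _)))).
by rewrite (row_free_inj fC (etrans uC (esym (mul0mx _ _)))) row_mx0 sub0mx.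
Qed.

(** The second block of the chart spans the orthogonal complement of the
first, so that coordinates in the chart are tilts towards the fibre of the
bundle. *)
Definition orthogonal_chart (R : realType) (k n : nat) (c : ochart R k n) :
    Prop :=
  forall v : 'rV[R]_n,
    v *m (chartA c)^T = 0 <-> exists x, v = x *m chartC c.

Lemma exists_orthogonal_chart (R : realType) (k n : nat) (P : ograss R k n) :
  exists2 c : ochart R k n, oparam c 0 = P & orthogonal_chart c.
Proof.
case: P => V O [A bA OE].
have fA : row_free A.
  have /andP[_] := bA.
  have -> : rows_seq A = [tuple row i A | i < k] by [].
  move/freeP => f; rewrite -kermx_eq0 -submx0; apply/rV_subP => u.
  move/sub_kermxP; rewrite mulmx_sum_row => uA.
  rewrite (_ : u = 0) ?sub0mx //; apply/rowP => i; rewrite mxE.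
  apply: f; rewrite -[RHS]uA; apply: eq_bigr => j _.
  by rewrite nth_rows_seq.
have [C [fC CP]] := exists_orthogonal_complement fA.
exists (OChart fC) => //.
rewrite /oparam /ospan /=.
move: (chart_row_free _ _) => /=.
rewrite mul0mx addr0 => fA0.
have VE : <<rows_seq A>>%VS = V by exact: span_basis bA.
subst V O; congr OGrass; exact: Prop_irrelevance.
Qed.

(** * Derivatives along lines *)

Lemma mx_linear_continuous (R : realType) (m n : nat) (V : normedModType R)
    (f : {linear 'M[R]_(m, n) -> V}) : continuous f.
Proof.
have -> : f = (fun A => \sum_i \sum_j A i j *: f (delta_mx i j)) :> (_ -> _).
  apply/funext => A; rewrite {1}[A]matrix_sum_delta linear_sum.
  apply: eq_bigr => i _; rewrite linear_sum; apply: eq_bigr => j _.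
  by rewrite linearZ.
move=> A; have addc := @add_continuous V.
apply: (@cvg_big V _ _ _ xpredT addc _ (nbhs A)) => i _.
apply: (@cvg_big V _ _ _ xpredT addc _ (nbhs A)) => j _.
by apply: cvgZr_tmp; exact: coord_continuous.
Qed.

Lemma is_diff_mx_linear (R : realType) (m n : nat) (V : normedModType R)
    (f : {linear 'M[R]_(m, n) -> V}) (A : 'M[R]_(m, n)) :
  is_diff A f f.
Proof.
have fc := mx_linear_continuous (f := f).
by apply: DiffDef; [exact: linear_differentiable|exact: diff_lin].
Qed.

Lemma is_derive_dotr_line (R : realType) (m n : nat)
    (F : 'rV[R]_m -> 'rV[R]_n) (z v : 'rV[R]_m) (w : 'rV[R]_n) (t : R) :
  differentiable F (z + t *: v) ->
  is_derive t 1 (fun s : R => dotr (F (z + s *: v)) w)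
    (dotr ('d F (z + t *: v) v) w).
Proof.
move=> dF; pose L : 'rV[R]_n -> R := fun y => dotr y w.
have L_lin : linear L by move=> a y y'; rewrite /L dotrDl dotrZl.
pose LL : {linear 'rV[R]_n -> R} :=
  HB.pack L (GRing.isLinear.Build _ _ _ _ _ L_lin).
have dL y : is_diff y (L : _ -> _) L by exact: (is_diff_mx_linear LL).
have dl : is_diff t (fun s : R => z + s *: v) (fun s => s *: v).
  by rewrite -[X in is_diff _ _ X]add0r; exact: is_diffD.
have dFl : is_diff (z + t *: v) F ('d F (z + t *: v)) by exact: DiffDef.
have [dh dhE] := is_diff_comp (is_diff_comp dl dFl) (dL _).
apply: DeriveDef; first exact: diff_derivable dh.
by rewrite (deriveE _ dh) dhE /= scale1r.
Qed.

Lemma derive0_eq01 (R : realType) (g : R -> R) :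
  (forall t : R, 0 <= t <= 1 -> is_derive t 1 g 0) -> g 1 = g 0.
Proof.
move=> dg; apply/eqP; rewrite -subr_eq0; apply/eqP.
have [|||c _ ->] := @MVT_segment R g (cst 0) 0 1; first exact: ler01.
- by move=> t; rewrite in_itv /= => /andP[t0 t1]; apply: dg; rewrite !ltW.
- by apply: derivable_within_continuous => t; rewrite in_itv /= => /dg[].
- by rewrite mul0r.
Qed.

(** * The transport equation and its integration along rays *)

(** The ordinary differential equation of parallel transport for the bundle
pulled back to [S] by the tilts [z |-> Q_z], written for the components of [F]
in [S] only: the component along [e] is eliminated by [F z _|_ e + z]. *)
Definition transport_at (R : realType) (n : nat) (F : 'rV[R]_n -> 'rV[R]_n)
    (S : {vspace 'rV[R]_n}) (z : 'rV[R]_n) : Prop :=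
  differentiable F z /\
  {in S &, forall v w, (1 + dotr z z) * dotr ('d F z v) w =
    - (dotr (F z) v * dotr z w)}.

(** Moving along the ray of [z], the transport equation only changes the
component of [F] in the direction of the ray. *)
Lemma transport_ray_normal (R : realType) (n : nat) (F : 'rV[R]_n -> 'rV[R]_n)
    (S : {vspace 'rV[R]_n}) (z w : 'rV[R]_n) :
  z \in S -> w \in S ->
  (forall t : R, 0 <= t <= 1 -> transport_at F S (t *: z)) ->
  dotr z w = 0 -> dotr (F z) w = dotr (F 0) w.
Proof.
move=> zS wS trF zw0.
pose g (s : R) := dotr (F (0 + s *: z)) w.
have -> : dotr (F z) w = g 1 by rewrite /g add0r scale1r.
have -> : dotr (F 0) w = g 0 by rewrite /g add0r scale0r.
apply: derive0_eq01 => t /trF [dF eqF].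
rewrite -[t *: z]add0r in dF.
apply: (is_derive_eq (is_derive_dotr_line w dF)); rewrite add0r.
apply/eqP; have := eqF z w zS wS.
rewrite (dotrZl t z w) zw0 !mulr0 oppr0 => /eqP.
by rewrite mulf_eq0 gt_eqF // ltr_wpDr ?dotr_ge0.
Qed.

(** With [N(t) = <F (t z), z>] and [r = |z|^2], the transport equation is
[(1 + r t^2) N' = - r t N], which has the first integral
[N^2 (1 + r t^2)]. *)
Lemma transport_ray_tangent (R : realType) (n : nat)
    (F : 'rV[R]_n -> 'rV[R]_n) (S : {vspace 'rV[R]_n}) (z : 'rV[R]_n) :
  z \in S -> (forall t : R, 0 <= t <= 1 -> transport_at F S (t *: z)) ->
  dotr (F z) z ^+ 2 * (1 + dotr z z) = dotr (F 0) z ^+ 2.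
Proof.
move=> zS trF; set r := dotr z z.
pose N (s : R) := dotr (F (0 + s *: z)) z.
pose g (s : R) := N s ^+ 2 * (1 + r * s ^+ 2).
have -> : dotr (F z) z ^+ 2 * (1 + r) = g 1.
  by rewrite /g /N add0r scale1r expr1n mulr1.
have -> : dotr (F 0) z ^+ 2 = g 0.
  by rewrite /g /N add0r scale0r expr0n mulr0 addr0 mulr1.
apply: derive0_eq01 => t /trF [dF eqF].
rewrite -[t *: z]add0r in dF.
have [d dN e] : exists2 d : R, is_derive t 1 N d &
    (1 + t * (t * r)) * d = - (N t * (t * r)).
  exists (dotr ('d F (0 + t *: z) z) z); first exact: is_derive_dotr_line.
  by have := eqF z z zS zS; rewrite !dotrZl !dotrZr -/r /N add0r.
apply: is_derive_eq; rewrite /GRing.scale /=.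
suff -> : N t ^+ 2 * ((0 + 1) * (r * (t * 1 + t * 1))) +
    (1 + r * t ^+ 2) * (N t * d + N t * d) =
    2 * N t * ((1 + t * (t * r)) * d + N t * (t * r)) by rewrite e addNr mulr0.
by ring.
Qed.

(** The curvature obstruction: along a ray orthogonal to [f = F 0] the
component [<F, f>] is constant, whereas the first integrals along the
neighbouring rays force it to vary. *)
Lemma transport_obstruction (R : realType) (n : nat)
    (F : 'rV[R]_n -> 'rV[R]_n) (S : {vspace 'rV[R]_n}) (h : 'rV[R]_n) :
  (\forall z \near (0 : 'rV[R]_n), z \in S -> transport_at F S z) ->
  F 0 \in S -> h \in S -> dotr (F 0) (F 0) = 1 -> dotr h h = 1 ->
  dotr (F 0) h <> 0.
Proof.
move=> trF; set f := F 0 => fS hS f1 h1 fh0.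
have [e /= e0 trFe] := (nbhs_normP _ _).1 trF.
have ray z : `|z| < e -> z \in S ->
    forall t : R, 0 <= t <= 1 -> transport_at F S (t *: z).
  move=> ze zS t /andP[t0 t1]; apply: trFe; last exact: memvZ.
  rewrite /= sub0r normrN normrZ ger0_norm //.
  by apply: le_lt_trans ze; rewrite ler_piMl.
(* Any q > 0 with q h in the ball of radius e would do. *)
pose q := e / ((1 + `|h|) * 2).
have q0 : 0 < q by rewrite divr_gt0 // mulr_gt0 // ltr_pwDl.
have qhe : `|q *: h| < e.
  have h0 := normr_ge0 h.
  have eE : e = q * ((1 + `|h|) * 2).
    by rewrite /q divfK // mulf_neq0 // gt_eqF // ltr_pwDl.
  by rewrite normrZ gtr0_norm // eE ltr_pM2l //; lra.
have qhS : q *: h \in S by exact: memvZ.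
have [dF eqF] : transport_at F S (q *: h).
  by rewrite -[q *: h]scale1r; apply: ray; rewrite // ler01 lexx.
rewrite -[q *: h]addr0 -[0](scale0r f) in dF.
pose N (p : R) := dotr (F (q *: h + p *: f)) (q *: h + p *: f).
have NE p : N p = dotr (F (q *: h + p *: f)) (q *: h) +
    p * dotr (F (q *: h + p *: f)) f by rewrite /N dotrDr dotrZr.
have dotz p : dotr (q *: h + p *: f) (q *: h + p *: f) = q ^+ 2 + p ^+ 2.
  rewrite !(dotrDl, dotrDr, dotrZl, dotrZr) h1 f1 fh0 (dotrC h) fh0; ring.
(* The first integral along the ray through q h + p f. *)
have NP : \forall p \near (0 : R),
    N p ^+ 2 * (1 + (q ^+ 2 + p ^+ 2)) = p ^+ 2.
  have : \forall p \near (0 : R), `|q *: h + p *: f| < e.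
    have : `|q *: h + p *: f| @[p --> (0 : R)] --> `|q *: h + 0 *: f|.
      apply: cvg_norm; apply: cvgD; first exact: cvg_cst.
      by apply: cvgZr_tmp; exact: cvg_id.
    by rewrite scale0r addr0 => /cvgr_lt; apply.
  apply: filterS => p pe.
  have zS : q *: h + p *: f \in S by rewrite memvD ?memvZ.
  rewrite -dotz (transport_ray_tangent zS (ray _ pe zS)).
  by rewrite -/f dotrDr !dotrZr f1 fh0 mulr0 add0r mulr1.
have N0 : N 0 = 0.
  have := nbhs_singleton NP; rewrite expr0n addr0 /=.
  move=> /eqP; rewrite mulf_eq0 expf_eq0 /= => /orP[/eqP //|].
  by rewrite gt_eqF // ltr_pwDl // sqr_ge0.
have F1 : dotr (F (q *: h)) f = 1.
  rewrite (@transport_ray_normal _ _ _ S) //; first exact: ray.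
  by rewrite dotrZl (dotrC h) fh0 mulr0.
have q1 : 1 + q ^+ 2 != 0 by rewrite gt_eqF // ltr_pwDl // sqr_ge0.
(* 1 - q^2 / (1 + q^2), by the transport equation at q h. *)
have dN : is_derive (0 : R) (1 : R) N (1 + q ^+ 2)^-1.
  have [d du dE] : exists2 d : R,
      is_derive (0 : R) (1 : R)
        (fun p => dotr (F (q *: h + p *: f)) (q *: h)) d &
      (1 + q ^+ 2) * d = - q ^+ 2.
    exists (dotr ('d F (q *: h + 0 *: f) f) (q *: h)).
      exact: is_derive_dotr_line.
    have := eqF f (q *: h) fS qhS.
    have := dotz 0; rewrite scale0r addr0 => ->.
    by rewrite expr0n addr0 F1 mul1r.
  have [d' dv] : exists d' : R, is_derive (0 : R) (1 : R)
      (fun p => dotr (F (q *: h + p *: f)) f) d'.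
    by exists (dotr ('d F (q *: h + 0 *: f) f) f); exact: is_derive_dotr_line.
  rewrite (funext NE).
  apply: is_derive_eq; rewrite !scale0r addr0 F1 add0r /GRing.scale /= mulr1.
  apply: (mulfI q1); rewrite mulrDr dE mulfV // mulr1; ring.
(* As N 0 = 0, N p / p is a difference quotient; the two limits below are the
   values of N'(0)^2 (1 + q^2) predicted by dN and by NP. *)
have lim1 : (N p / p) ^+ 2 * (1 + (q ^+ 2 + p ^+ 2)) @[p --> 0^'] -->
    (1 + q ^+ 2)^-1 ^+ 2 * (1 + (q ^+ 2 + 0 ^+ 2)).
  have limN : N p / p @[p --> 0^'] --> (1 + q ^+ 2)^-1.
    have [Nc <-] := dN.
    have -> : (fun p => N p / p) =
        (fun p => p^-1 *: ((N \o shift 0) p%:A - N 0)).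
      apply/funext => p.
      by rewrite N0 subr0 /= addr0 /GRing.scale /= mulr1 mulrC.
    exact: Nc.
  have limid : (p : R) @[p --> 0^'] --> (0 : R) by exact: nbhs_dnbhs.
  apply: cvgM; first exact: (cvgM limN limN).
  apply: cvgD; first exact: cvg_cst.
  by apply: cvgD; [exact: cvg_cst|exact: (cvgM limid limid)].
have lim2 : (N p / p) ^+ 2 * (1 + (q ^+ 2 + p ^+ 2)) @[p --> 0^'] --> (1 : R).
  have near1 : \forall p \near (0 : R)^',
      1 = (N p / p) ^+ 2 * (1 + (q ^+ 2 + p ^+ 2)).
    apply: filterS2 (nbhs_dnbhs NP) (nbhs_dnbhs_neq (0 : R)) => p Np p0.
    by rewrite exprMn mulrAC Np exprVn divff // sqrf_eq0.
  exact: cvg_trans (near_eq_cvg near1) (cvg_cst _).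
have : (1 + q ^+ 2)^-1 ^+ 2 * (1 + (q ^+ 2 + 0 ^+ 2)) = 1.
  exact: (cvg_unique (@norm_hausdorff _ _) lim1 lim2).
rewrite expr0n addr0 [_^-1 ^+ 2]expr2 -mulrA mulVf // mulr1 => /eqP.
by rewrite invr_eq1 -subr_eq0 [1 + _]addrC addrK expf_eq0 /= gt_eqF.
Qed.

(** * The transport equation for parallel sections *)

(** The chart coordinates of the graph of [w |-> <w, e> z] over the subspace
spanned by [chartA c], for [z] in the span of [chartC c]. *)
Definition tilt (R : realType) (k n : nat) (c : ochart R k n) (e : 'rV[R]_n) :
    {linear 'rV[R]_n -> 'M[R]_(k, n - k)} :=
  GRing.Linear.clone _ _ _ _
    (mulmxr (pinvmx (chartC c)) \o mulmx (chartA c *m e^T)) _.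

Lemma mul_tilt (R : realType) (k n : nat) (c : ochart R k n)
    (e y : 'rV[R]_n) (u : 'rV[R]_k) :
  y \in <<rows_seq (chartC c)>>%VS ->
  u *m (chartA c + tilt c e y *m chartC c) =
    u *m chartA c + dotr (u *m chartA c) e *: y.
Proof.
move=> /mem_span_rows[x yE].
have yK : y *m pinvmx (chartC c) *m chartC c = y.
  by rewrite mulmxKpV // yE submxMl.
have -> : tilt c e y *m chartC c = chartA c *m e^T *m y.
  by rewrite -[in RHS]yK /= !mulmxA.
rewrite mulmxDr !mulmxA; congr (_ + _).
by rewrite [u *m chartA c *m e^T]mx11_scalar mul_scalar_mx.
Qed.

(** A derivative of a parallel section at [Q_z] lies in [Q_z], so it is
[w + <w, e> z] for some [w] in [P].  Pairing it with [S] and with [e + z]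
expresses everything through [<w, e>], which the derivative of
[<F z, e + z> = 0] determines. *)
Lemma parallel_transport_at (R : realType) (k n : nat) (c : ochart R k n)
    (U : set (ograss R k n)) (s : ograss R k n -> ograss R k n * 'rV[R]_n)
    (e z : 'rV[R]_n) :
  orthogonal_chart c -> open U ->
  section_over (E1bundle R k n) U s -> smooth_section U s -> parallel U s ->
  (exists u, e = u *m chartA c) -> dotr e e = 1 ->
  U (oparam c (tilt c e z)) -> z \in <<rows_seq (chartC c)>>%VS ->
  transport_at (fun y => (s (oparam c (tilt c e y))).2)
    <<rows_seq (chartC c)>>%VS z.
Proof.
set A := chartA c; set C := chartC c; set S := <<rows_seq C>>%VS.
set ell := tilt c e.
move=> CP Uo sU sm par [u0 eE] e1 Uz zS.
pose phi X := (s (oparam c X)).2.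
have dphi : differentiable phi (ell z) := (sm c 1%N).1 _ Uz.
have dell := is_diff_mx_linear ell z.
have dphi' : is_diff (ell z) phi ('d phi (ell z)) by exact: DiffDef.
have [dF dFE] := is_diff_comp dell dphi'.
split; first exact: dF.
have FE v : 'd (fun z => (s (oparam c (ell z))).2) z v = 'd phi (ell z) (ell v).
  by rewrite dFE.
have orthA y u : y \in S -> dotr y (u *m A) = 0.
  by move=> /mem_span_rows/CP yA; rewrite dotr_mulmxr yA dotr0l.
have rowsE y u : y \in S ->
    u *m (A + ell y *m C) = u *m A + dotr (u *m A) e *: y := mul_tilt e u.
move=> v w vS wS; rewrite FE.
have [u dE] : exists u, 'd phi (ell z) (ell v) = u *m (A + ell z *m C).
  apply/mem_span_rows.
  have := congr1 snd (par _ Uz (TVec (ell v) (erefl (oparam c (ell z))))).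
  rewrite /nabla /= => pr0.
  have := eproj_sub (osub (oparam c (ell z))) ('d phi (ell z) (ell v)).
  rewrite [X in _ - X]pr0 subr0; exact.
rewrite dE rowsE //; set lam := dotr _ e.
rewrite dotrDl dotrZl [dotr _ w]dotrC orthA // add0r.
(* The equation says that the derivative at t = 0 of <F y, e + y>, where
   y = z + t v, vanishes. *)
suff : lam * (1 + dotr z z) + dotr (phi (ell z)) v = 0.
  move/eqP; rewrite addrC addr_eq0 => /eqP ->; ring.
have orthF y : y \in S -> U (oparam c (ell y)) ->
    dotr (phi (ell y)) (e + y) = 0.
  move=> yS Uy; have [[+ _] PE] := sU _ Uy.
  rewrite /Ebundle /= PE => /mem_orthov; rewrite dotrC; apply.
  apply/mem_span_rows; exists u0; rewrite rowsE //= -eE e1 scale1r //.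
have near_line : \forall t \near (0 : R), U (oparam c (ell (z + t *: v))).
  have linez : ell (z + t *: v) @[t --> (0 : R)] --> ell (z + 0 *: v).
    apply: continuous_cvg; first exact: mx_linear_continuous.
    apply: cvgD; first exact: cvg_cst.
    by apply: cvgZr_tmp; exact: cvg_id.
  rewrite scale0r addr0 in linez.
  have DU : nbhs (ell z) (oparam c @^-1` U).
    by apply: open_nbhs_nbhs; split; [exact: Uo|].
  exact: (linez _ DU).
have [d d1 dE1] : exists2 d : R,
    is_derive (0 : R) (1 : R)
      (fun t => dotr (phi (ell (z + t *: v))) (e + z)) d &
    d = lam * (1 + dotr z z).
  exists (dotr ('d (fun y => (s (oparam c (ell y))).2) (z + 0 *: v) v) (e + z)).
    by apply: is_derive_dotr_line; rewrite scale0r addr0.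
  have ze : dotr z e = 0 by rewrite eE orthA.
  rewrite scale0r addr0 FE dE rowsE // !(dotrDl, dotrDr, dotrZl) ze -/lam.
  rewrite [dotr (u *m A) z]dotrC orthA //; ring.
have [d' d2] : exists d' : R, is_derive (0 : R) (1 : R)
    (fun t => dotr (phi (ell (z + t *: v))) v) d'.
  exists (dotr ('d (fun y => (s (oparam c (ell y))).2) (z + 0 *: v) v) v).
  by apply: is_derive_dotr_line; rewrite scale0r addr0.
pose g t := dotr (phi (ell (z + t *: v))) (e + z) +
  t * dotr (phi (ell (z + t *: v))) v.
have dg : is_derive (0 : R) (1 : R) g (d + dotr (phi (ell z)) v).
  apply: is_derive_eq; rewrite !scale0r addr0 add0r /GRing.scale /= mulr1 //.
have g0 : \forall t \near (0 : R), g t = 0.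
  apply: filterS near_line => t /orthF gt; rewrite -(gt _) ?memvD ?memvZ //.
  by rewrite /g !dotrDr dotrZr addrA.
rewrite -dE1 -(derive_val (is_derive := dg)).
by rewrite (near_eq_derive _ g0) ?oner_neq0 // derive_cst.
Qed.

(** * Nonexistence of parallel sections *)

(** The codimension [n - k >= 2] leaves room in the fibre for a unit vector
orthogonal to the section, along which [transport_obstruction] applies. *)
Lemma no_parallel_section (R : realType) (k n : nat) (U : set (ograss R k n))
    (s : ograss R k n -> ograss R k n * 'rV[R]_n) :
  (0 < k)%N -> (k.+1 < n)%N -> open U -> U !=set0 ->
  section_over (E1bundle R k n) U s -> smooth_section U s -> ~ parallel U s.
Proof.
move=> k0 kn Uo [P UP] sU sm par.
have [c cP CP] := exists_orthogonal_chart P.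
set A := chartA c; set C := chartC c; rewrite /orthogonal_chart -/A -/C in CP.
have [e [u eE] e1] : exists2 e, exists u, e = u *m A & dotr e e = 1.
  have fA : row_free A by have := chart_row_free c 0; rewrite mul0mx addr0.
  have /dotr_normalize[a a1] : (const_mx 1 : 'rV[R]_k) *m A != 0.
    apply/eqP => oneA.
    move/rowP: (row_free_inj fA (etrans oneA (esym (mul0mx _ A)))).
    by move=> /(_ (Ordinal k0))/eqP; rewrite !mxE oner_eq0.
  by exists (a *: (const_mx 1 *m A)) => //; exists (a *: const_mx 1);
     rewrite scalemxAl.
set ell := tilt c e.
pose F z := (s (oparam c (ell z))).2.
have ell0 : ell 0 = 0 by exact: linear0.
have F0 : F 0 = (s P).2 by rewrite /F ell0 cP.
have inS v : v *m A^T = 0 -> v \in <<rows_seq C>>%VS.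
  by move=> /CP/mem_span_rows.
have [[F0P F01] PE] := sU _ UP.
have F0A : F 0 *m A^T = 0.
  apply/eqP; rewrite -dotr_eq0 -dotr_mulmxr F0 dotrC; apply/eqP.
  move: F0P; rewrite /Ebundle /= PE => /mem_orthov; apply.
  rewrite -cP; apply/mem_span_rows; exists ((s P).2 *m A^T).
  by rewrite cP mul0mx addr0.
have [h [hB h1]] : exists h : 'rV[R]_n,
    h *m (col_mx A (F 0))^T = 0 /\ dotr h h = 1.
  apply: exists_unit_orthogonal; rewrite addn1; exact: kn.
rewrite tr_col_mx mul_mx_row -row_mx0 in hB.
have [hA hF] := eq_row_mx hB.
apply: (@transport_obstruction _ _ F <<rows_seq C>>%VS h).
- have near0 : \forall z \near (0 : 'rV[R]_n), U (oparam c (ell z)).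
    have DU : nbhs (ell 0) (oparam c @^-1` U).
      apply: open_nbhs_nbhs; split; first exact: Uo.
      by change (U (oparam c (ell 0))); rewrite ell0 cP.
    exact: (mx_linear_continuous DU).
  apply: filterS near0 => z Uz zS.
  apply: (parallel_transport_at CP Uo sU sm par _ e1 Uz zS).
  by exists u.
- exact: inS.
- exact: inS.
- by rewrite F0 -[LHS]sqr_sqrtr ?dotr_ge0 // -/(enorm _) F01 expr1n.
- exact: h1.
- by rewrite dotrC /dotr hF mxE.
Qed.

Theorem proposition3 (R : realType) (k n : nat)
    (hkn : (k, n) = (2, 7)%N \/ (k, n) = (3, 8)%N)
    (U : set (ograss R k n)) (Uopen : open U) (Une : U !=set0) :
  ~ exists s : ograss R k n -> ograss R k n * 'rV[R]_n,
      [/\ section_over (E1bundle R k n) U s,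
          smooth_section U s & parallel U s].
Proof.
case=> s [sU sm par].
have [k0 kn] : (0 < k /\ k.+1 < n)%N by case: hkn => -[-> ->].
exact: no_parallel_section k0 kn Uopen Une sU sm par.
Qed.
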